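(* For all integers $k,r\ge0$ one has $B_{k,0,r}\ge0$, and for all integers $k\ge2$, $r\ge0$ one has $B_{k,1,r}\ge0$. More precisely, $$B_{k,0,r}=\mathfrak{D}(r,k)+\mathfrak{D}(r+1,k),$$ and $$\begin{aligned}B_{k,1,r}={}&r(r+2-k)\,\mathfrak{D}(r+1,k-1)+r(3r+2-3k)\,\mathfrak{D}(r,k-1)\\&+(3r^2-3kr-2r+k+1)\,\mathfrak{D}(r-1,k-1)\\&+(r-1)(r-k-1)\,\mathfrak{D}(r-2,k-1).\end{aligned}$$
   Context: For integers $k,d\ge0$ let $c_k(2,d)\in\mathbb{Z}[x_1,x_2]$ be the homogeneous degree-$k$ part of $\prod_{i=0}^d(1+ix_1+(d-i)x_2)$. Expand it in two-variable Schur polynomials: $$c_k(2,d)=\sum_{0\le j\le\lfloor k/2\rfloor}A_{k,j}(d)\,s_{(k-j,j)}(x_1,x_2).$$ For fixed $k,j$ with $0\le j\le\lfloor k/2\rfloor$, $A_{k,j}(d)$ is a polynomial function of $d$, and the numbers $B_{k,j,r}$ $(r\ge0)$ are its coefficients in the binomial basis: $A_{k,j}(d)=\sum_{r\ge0}B_{k,j,r}\binom dr$. $\mathfrak{D}(N,K)$ denotes the number of fixed-point-free permutations of an $N$-element set having exactly $N-K$ cycles, with $\mathfrak{D}(0,0)=1$ and $\mathfrak{D}(N,K)=0$ outside the natural range (in particular for $N<0$ or $K<0$). *)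

(* Defs.v *)
From mathcomp Require Import all_boot all_order all_fingroup all_algebra.
From mathcomp Require Export mpoly.

Set Implicit Arguments.
Unset Strict Implicit.
Unset Printing Implicit Defensive.

Import GRing.Theory.
Local Open Scope ring_scope.

Lemma alternant_quotient (R : comNzRingType) (x y : R) (a b : nat) :
  (b <= a)%N ->
  (\sum_(i < (a - b).+1) x ^+ (a - i) * y ^+ (b + i)) * (x - y) =
  x ^+ a.+1 * y ^+ b - x ^+ b * y ^+ a.+1.
Proof.
move=> le_ba.
have -> : \sum_(i < (a - b).+1) x ^+ (a - i) * y ^+ (b + i) =
          (x ^+ b * y ^+ b) * \sum_(i < (a - b).+1) x ^+ (a - b - i) * y ^+ i.
  rewrite big_distrr; apply: eq_bigr => i _ /=.
  have hi : (i <= a - b)%N by rewrite -ltnS.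
  have -> : (a - i = b + (a - b - i))%N by rewrite addnBA // subnKC.
  by rewrite !exprD mulrACA.
rewrite -mulrA [_ * (x - y)]mulrC -subrXX.
have -> : a.+1 = (b + (a - b).+1)%N by rewrite addnS subnKC.
by rewrite 2!exprD mulrBr mulrAC mulrA.
Qed.

Definition x1 : {mpoly int[2]} := 'X_ord0.
Definition x2 : {mpoly int[2]} := 'X_ord_max.

Definition c2 (k d : nat) : {mpoly int[2]} :=
  pihomog mdeg k (\prod_(i < d.+1) (1 + x1 *+ i + x2 *+ (d - i))).

(* For b <= a, a semistandard tableau of shape (a, b) with entries in {1, 2}
   has b columns "1 over 2" followed by a - b columns of height one, the last
   i of which contain 2; its weight is x1^(a - i) x2^(b + i). *)
Definition schur2 (a b : nat) : {mpoly int[2]} :=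
  \sum_(i < (a - b).+1) x1 ^+ (a - i) * x2 ^+ (b + i).

(* Cauchy's ratio of alternants. *)
Lemma schur2_alternant (a b : nat) : (b <= a)%N ->
  schur2 a b * (x1 - x2) =
  x1 ^+ a.+1 * x2 ^+ b - x1 ^+ b * x2 ^+ a.+1.
Proof. exact: alternant_quotient. Qed.

Definition schur_coefficients (A : nat -> nat -> nat -> int) : Prop :=
  forall k d : nat,
    c2 k d = \sum_(j < (k./2).+1) A k j d *: schur2 (k - j) j.

(* [f] is the polynomial function with (finitely supported) coefficients [b]
   in the basis of binomial coefficients; both are then determined by [f], as
   the values on [nat] determine a polynomial. *)
Definition binomial_coefficients (f : nat -> int) (b : nat -> rat) : Prop :=
  exists N : nat,
    (forall r : nat, (N <= r)%N -> b r = 0) /\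
    (forall d : nat, (f d)%:~R = \sum_(r < N) b r * 'C(d, r)%:R).

(* Fixed points count as cycles in [porbits]. The arguments are integers, and
   [N - K] is the integer difference: the value is 0 if it is negative, and
   also if [K < 0], since a permutation has at most [n] cycles. *)
Definition derangements (N K : int) : nat :=
  match N with
  | Posz n => #|[set s : 'S_n | [forall i, s i != i]
                                & #|porbits s|%:Z == N - K]|
  | Negz _ => 0
  end.

(* Main.v *)
(* With e_k = e_k(0, 1, ..., d), the coefficients of x1^k and x1^(k-1) x2 in
   c_k(2, d) are e_k and d (d + 2 - k) e_(k-1) - k e_k. At these monomials s_(k)
   has coefficients 1 and 1, and s_(k-1,1) has coefficients 0 and 1, whence
   A_(k,0) = e_k and A_(k,1) = d (d + 2 - k) e_(k-1) - (k + 1) e_k. Erasing a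
   point from its cycle yields D(n+1, k) = n (D(n, k-1) + D(n-1, k-1)), and by
   induction on d this turns the recurrence
     e_k(0, ..., d + 1) = e_k(0, ..., d) + (d + 1) e_(k-1)(0, ..., d)
   into e_k = sum_r (D(r, k) + D(r+1, k)) C(d, r). Multiplication by d replaces
   the coefficients b_r in the binomial basis by r (b_r + b_(r-1)), which gives
   the formula for B_(k,1,r). Each of its four terms is nonnegative, because
   D(n, m) = 0 for 0 < m and n <= m. *)
Require Import Defs.
From mathcomp Require Import all_boot all_order all_fingroup all_algebra.
From mathcomp Require Import ring zify.
Import GRing.Theory Num.Theory.
Set Implicit Arguments.
Unset Strict Implicit.
Local Open Scope ring_scope.

(** * Permutations fixing a given point *)

Section LiftPerm.

Variables (n : nat) (i : 'I_n.+1).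

Lemma lift_perm_inj : injective (@lift_perm n i i).
Proof.
move=> s t eq_st; apply/permP => k; apply: (@lift_inj _ i).
by rewrite -!(@lift_perm_lift _ i i) eq_st.
Qed.

Lemma lift_perm_surj (s : 'S_n.+1) : s i = i -> exists t, s = lift_perm i i t.
Proof.
(* The default [k] is never taken: [s (lift i k) = i = s i] would force [lift i k = i]. *)
move=> si; pose f k := odflt k (unlift i (s (lift i k))).
have fK k : lift i (f k) = s (lift i k).
  rewrite /f; case: unliftP => [j ->//|].
  by rewrite -{2}si => /perm_inj /eqP; rewrite eq_sym (negPf (neq_lift _ _)).
have f_inj : injective f.
  by move=> k l eq_f; apply/(@lift_inj _ i)/(@perm_inj _ s); rewrite -!fK eq_f.
exists (perm f_inj); apply/permP => k.
case: (unliftP i k) => [j|] ->; last by rewrite lift_perm_id.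
by rewrite lift_perm_lift permE fK.
Qed.

Lemma lift_permX (s : 'S_n) m :
  (lift_perm i i s ^+ m)%g = lift_perm i i (s ^+ m)%g.
Proof.
by elim: m => [|m IH]; rewrite ?expg0 ?lift_perm1 // !expgS IH lift_permM.
Qed.

Lemma porbit_lift_perm_id (s : 'S_n) : porbit (lift_perm i i s) i = [set i].
Proof.
apply/setP => j; rewrite inE; apply/porbitP/eqP => [[m ->]|->].
  by rewrite lift_permX lift_perm_id.
by exists 0%N; rewrite expg0 perm1.
Qed.

Lemma porbit_lift_perm_lift (s : 'S_n) k :
  porbit (lift_perm i i s) (lift i k) = lift i @: porbit s k.
Proof.
apply/setP => j; apply/porbitP/imsetP => [[m ->]|[l /porbitP [m ->] ->]].
  rewrite lift_permX lift_perm_lift.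
  by exists ((s ^+ m)%g k) => //; apply: mem_porbit.
by exists m; rewrite lift_permX lift_perm_lift.
Qed.

(** The cycles are the fixed point [i] and the lifted cycles of [s], none of which contains [i]. *)
Lemma card_porbits_lift_perm (s : 'S_n) :
  #|porbits (lift_perm i i s)| = #|porbits s|.+1.
Proof.
have -> : porbits (lift_perm i i s)
          = [set i] |: [set lift i @: C | C : {set 'I_n} in porbits s].
  apply/setP => C; rewrite !inE; apply/imsetP/orP.
    case=> j _ ->; case: (unliftP i j) => [k|] ->; last first.
      by left; rewrite porbit_lift_perm_id.
    by right; rewrite porbit_lift_perm_lift; do 2!apply: imset_f.
  case=> [/eqP ->|/imsetP [_ /imsetP [k _ ->] ->]].
    by exists i; rewrite ?porbit_lift_perm_id.
  by exists (lift i k); rewrite ?porbit_lift_perm_lift.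
rewrite cardsU1 (card_imset _ (imset_inj (@lift_inj _ i))).
case: imsetP => // -[C _] /setP /(_ i); rewrite inE eqxx.
by move=> /esym /imsetP [k _] /eqP; rewrite (negPf (neq_lift _ _)).
Qed.

End LiftPerm.

(** * Derangements counted by their cycles *)

Definition derangement {T : finType} (s : {perm T}) : bool :=
  [forall i, s i != i].

(* [z] is an integer so that the recurrence below needs no case distinction. *)
Definition num_derangements (n : nat) (z : int) : nat :=
  #|[set s : 'S_n | derangement s & #|porbits s|%:Z == z]|.

Lemma num_derangements0 z : num_derangements 0 z = (z == 0).
Proof.
have card0 (s : 'S_0) : #|porbits s| = 0%N.
  by apply/eqP; rewrite cards_eq0; apply/set0Pn => -[C /imsetP [[]]].
rewrite /num_derangements; case: (eqVneq z 0) => [->|z_neq0].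
  rewrite (eq_card (B := [set: 'S_0])) ?cardsT ?card_Sn // => s.
  by rewrite !inE card0 eqxx andbT; apply/forallP; case.
apply: eq_card0 => s; rewrite !inE card0 eq_sym (negPf z_neq0) andbF //.
Qed.

Lemma num_derangements1 z : num_derangements 1 z = 0%N.
Proof.
apply: eq_card0 => s; rewrite !inE; apply/negP => /andP [/forallP /(_ ord0)].
by rewrite ord1 eqxx.
Qed.

(** Either [y] moves and [s] is a derangement, or [y] is a cycle by itself and removing it leaves a
    derangement of [n] points with one cycle less. *)
Lemma card_derangements_but n (y : 'I_n.+1) (z : int) :
  #|[set s : 'S_n.+1 | [forall j, (j != y) ==> (s j != j)]
                       & #|porbits s|%:Z == z]|
  = (num_derangements n.+1 z + num_derangements n (z - 1))%N.
Proof.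
rewrite -(cardsID [set s : 'S_n.+1 | s y == y]) addnC; congr (_ + _)%N.
  apply: eq_card => s; rewrite !inE /derangement.
  case: (eqVneq (s y) y) => [sy|sy] /=.
    by symmetry; apply/negbTE/nandP; left; apply/forallPn; exists y;
      rewrite sy eqxx.
  congr (_ && _); apply: eq_forallb => j.
  by case: (eqVneq j y) => // ->; rewrite sy.
rewrite /num_derangements -(card_imset _ (@lift_perm_inj n y)).
apply: eq_card => s; rewrite !inE; apply/andP/imsetP.
  case=> /andP [H1 H2] /eqP sy.
  have [t def_s] := lift_perm_surj sy.
  exists t => //; rewrite inE; apply/andP; split.
    apply/forallP => k; move/forallP: H1 => /(_ (lift y k)).
    by rewrite def_s lift_perm_lift eq_sym neq_lift (inj_eq lift_inj).
  by rewrite -(eqP H2) def_s card_porbits_lift_perm -[_.+1]addn1 PoszD addrK.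
case=> t; rewrite inE => /andP [/forallP H1 /eqP H2] ->.
split; last by rewrite lift_perm_id.
apply/andP; split; last by rewrite card_porbits_lift_perm -addn1 PoszD H2 subrK.
apply/forallP => j; case: (unliftP y j) => [k|] ->; last by rewrite eqxx.
by rewrite lift_perm_lift (inj_eq lift_inj) H1 implybT.
Qed.

(* Every permutation [s] moving [ord0] is uniquely [tperm ord0 y * lift s'] with
   [y != ord0]: [s'] is obtained by erasing [ord0] from its cycle, so that the
   only fixed point of [s'] can be the one given by [y], when [s] is a
   derangement. *)
Lemma num_derangementsS n z :
  num_derangements n.+2 z =
  (n.+1 * (num_derangements n.+1 z + num_derangements n (z - 1)))%N.
Proof.
pose ins (p : 'I_n.+1 * 'S_n.+1) : 'S_n.+2 :=
  (tperm ord0 (lift ord0 p.1) * lift_perm ord0 ord0 p.2)%g.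
have insE0 p : ins p ord0 = lift ord0 (p.2 p.1).
  by rewrite permM tpermL lift_perm_lift.
have insEy p : ins p (lift ord0 p.1) = ord0.
  by rewrite permM tpermR lift_perm_id.
have insE p j : j != p.1 -> ins p (lift ord0 j) = lift ord0 (p.2 j).
  move=> jp; rewrite permM tpermD ?lift_perm_lift ?neq_lift //.
  by rewrite (inj_eq lift_inj) eq_sym.
have ins_inj : injective ins.
  move=> p p' eq_ins; have eq_y : p.1 = p'.1.
    apply/(@lift_inj _ ord0)/(@perm_inj _ (ins p)).
    by rewrite insEy eq_ins insEy.
  move: eq_ins; rewrite /ins -eq_y => /mulgI /lift_perm_inj eq_s.
  by apply/eqP; rewrite -pair_eqE /= eq_y eq_s !eqxx.
have card_ins p : #|porbits (ins p)| = #|porbits p.2|.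
  (* The transposition joins the one-point cycle of [ord0] to the cycle of [lift ord0 p.1], which
     cancels the extra cycle of [lift_perm]. *)
  have := porbits_mul_tperm (lift_perm ord0 ord0 p.2) ord0 (lift ord0 p.1).
  rewrite porbit_sym porbit_lift_perm_id inE eq_sym neq_lift /= addn2 addn1.
  by rewrite card_porbits_lift_perm -/(ins p) => -[].
pose Q (y : 'I_n.+1) := [set s : 'S_n.+1 | [forall j, (j != y) ==> (s j != j)]
                       & #|porbits s|%:Z == z].
have -> : num_derangements n.+2 z
          = #|[set p : 'I_n.+1 * 'S_n.+1 | p.2 \in Q p.1]|.
  rewrite -(card_imset _ ins_inj); apply: eq_card => s; rewrite !inE.
  apply/andP/imsetP => [[/forallP der /eqP cs]|[[y t]]].
    have [y def_y] : exists y, (s^-1)%g ord0 = lift ord0 y.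
      case: (unliftP ord0 ((s^-1)%g ord0)) => [y ->|]; first by exists y.
      by move=> e; have := der ((s^-1)%g ord0); rewrite permKV e eqxx.
    have sy : s (lift ord0 y) = ord0 by rewrite -def_y permKV.
    have [t def_t] : exists t,
        (tperm ord0 (lift ord0 y) * s)%g = lift_perm ord0 ord0 t.
      by apply: lift_perm_surj; rewrite permM tpermL.
    have def_s : s = ins (y, t) by rewrite /ins /= -def_t mulgA tperm2 mul1g.
    exists (y, t) => //; rewrite !inE /=; apply/andP; split.
      apply/forallP => j; apply/implyP => jy; have := der (lift ord0 j).
      by rewrite def_s insE // (inj_eq lift_inj).
    by rewrite -cs def_s card_ins.
  rewrite !inE /= => /andP [/forallP der /eqP cs] ->; split; last first.
    by rewrite card_ins cs.
  apply/forallP => j; case: (unliftP ord0 j) => [k|] ->; last first.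
    by rewrite insE0 eq_sym neq_lift.
  have [->|ky] := eqVneq k y; first by rewrite (insEy (y, t)) neq_lift.
  by rewrite insE // (inj_eq lift_inj) (implyP (der k)).
rewrite -sum1_card.
rewrite (eq_bigl (fun p : 'I_n.+1 * 'S_n.+1 => true && (p.2 \in Q p.1)));
  last by move=> p; rewrite inE.
rewrite -(pair_big_dep xpredT (fun y (s : 'S_n.+1) => s \in Q y)
  (fun _ _ => 1%N)) /=.
under eq_bigr => y _ do rewrite sum1_card card_derangements_but.
by rewrite sum_nat_const card_ord.
Qed.

Lemma derangementsE (n : nat) (z : int) :
  derangements n z = num_derangements n (n%:Z - z).
Proof. by []. Qed.

Lemma derangements0 (k : nat) : derangements 0%N k = (k == 0)%N.
Proof. by rewrite derangementsE num_derangements0 sub0r oppr_eq0. Qed.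

Lemma derangements1 (z : int) : derangements 1%N z = 0%N.
Proof. by rewrite derangementsE num_derangements1. Qed.

Lemma derangementsSS (n : nat) (z : int) :
  derangements n.+2 z =
  (n.+1 * (derangements n.+1 (z - 1) + derangements n (z - 1)))%N.
Proof.
rewrite !derangementsE num_derangementsS; congr (_ * (_ + _))%N.
  by congr num_derangements; rewrite -addn1 PoszD; ring.
by congr num_derangements; rewrite -addn2 PoszD; ring.
Qed.

Lemma derangements_lt0 (n : nat) (z : int) : z < 0 -> derangements n z = 0%N.
Proof.
elim/ltn_ind: n z => -[|[|n]] IH z z_lt0; last 2 first.
- exact: derangements1.
- by rewrite derangementsSS !IH //; lia.
rewrite derangementsE num_derangements0; case: eqP => // ; lia.
Qed.

(** Here n - z <= 0 cycles are prescribed; [0 < z] excludes the empty permutation with its 0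
    cycles. *)
Lemma derangements_ge (n : nat) (z : int) :
  0 < z -> n%:Z <= z -> derangements n z = 0%N.
Proof.
elim/ltn_ind: n z => -[|[|n]] IH z z_gt0 le_nz; last 2 first.
- exact: derangements1.
- by rewrite derangementsSS !IH //; lia.
rewrite derangementsE num_derangements0; case: eqP => // ; lia.
Qed.

(** * Expansions in the binomial basis *)

(** Since C(d, r) = 0 for r > d, stopping at [d] gives the whole expansion, whatever the support of
    [b]. *)
Definition binom_sum (b : nat -> int) (d : nat) : int :=
  \sum_(r < d.+1) b r * 'C(d, r)%:R.

Lemma eq_binom_sum (b c : nat -> int) : b =1 c -> binom_sum b =1 binom_sum c.
Proof. by move=> eq_bc d; apply: eq_bigr => r _; rewrite eq_bc. Qed.

Lemma binom_sumD (b c : nat -> int) d :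
  binom_sum (fun r => b r + c r) d = binom_sum b d + binom_sum c d.
Proof. by rewrite -big_split; apply: eq_bigr => r _; rewrite mulrDl. Qed.

Lemma binom_sumZ (a : int) (b : nat -> int) d :
  binom_sum (fun r => a * b r) d = a * binom_sum b d.
Proof. by rewrite mulr_sumr; apply: eq_bigr => r _; rewrite mulrA. Qed.

(** Pascal's rule and a shift of the index. *)
Lemma binom_sumS (b : nat -> int) d :
  binom_sum b d.+1 = binom_sum (fun r => b r + b r.+1) d.
Proof.
rewrite binom_sumD {1}/binom_sum big_ord_recl bin0.
under eq_bigr => r _ do rewrite lift0 binS natrD mulrDr.
rewrite big_split addrA; congr (_ + _).
rewrite big_ord_recr /= bin_small // mulr0 addr0.
by rewrite /binom_sum big_ord_recl bin0; congr (_ + _).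
Qed.

(** This rests on d C(d, r) = r C(d, r) + (r + 1) C(d, r + 1). At r = 0 the factor [r%:R] removes
    the truncated [r.-1]. *)
Lemma binom_sum_mulr (b : nat -> int) d :
  d%:R * binom_sum b d = binom_sum (fun r => r%:R * (b r + b r.-1)) d.
Proof.
under [RHS]eq_binom_sum => r do rewrite mulrDr.
rewrite binom_sumD.
rewrite -[X in _ = _ + X]/(\sum_(r < d.+1) r%:R * b r.-1 * 'C(d, r)%:R).
rewrite big_ord_recl /= mul0r mul0r add0r.
have -> : \sum_(r < d) r.+1%:R * b r * 'C(d, r.+1)%:R
          = \sum_(r < d.+1) (d - r)%:R * b r * 'C(d, r)%:R :> int.
  rewrite big_ord_recr /= subnn !mul0r addr0; apply: eq_bigr => r _.
  by rewrite mulrAC -natrM mul_bin_left natrM mulrAC.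
rewrite -big_split mulr_sumr; apply: eq_bigr => r _ /=.
by rewrite -mulrDl -mulrDl -natrD subnKC ?mulrA // -ltnS.
Qed.

Lemma binomial_coefficientsE (f : nat -> int) (b : nat -> rat)
  (c : nat -> int) :
  binomial_coefficients f b -> f =1 binom_sum c ->
  forall r, b r = (c r)%:~R.
Proof.
move=> [N [b0 fb]] fc.
have eq_sum d : \sum_(r < d.+1) b r * 'C(d, r)%:R
                = \sum_(r < d.+1) (c r)%:~R * 'C(d, r)%:R.
  transitivity (\sum_(r < N) b r * 'C(d, r)%:R); last first.
    rewrite -fb fc /binom_sum rmorph_sum; apply: eq_bigr => r _ /=.
    by rewrite rmorphM /= rmorph_nat.
  (* Both sums extend to [maxn N d.+1]: the added terms have [b r = 0] or C(d, r) = 0. *)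
  rewrite [RHS](big_ord_widen _ (fun r => b r * 'C(d, r)%:R) (leq_maxl N d.+1)).
  rewrite [LHS](big_ord_widen _ (fun r => b r * 'C(d, r)%:R) (leq_maxr N d.+1)).
  rewrite [LHS]big_mkcond [RHS]big_mkcond; apply: eq_bigr => r _.
  case: (ltnP r d.+1) => rd; case: (ltnP r N) => rN //.
    by rewrite b0 // mul0r.
  by rewrite bin_small // mulr0.
(* The system is unitriangular: at d = r the last term is [b r] itself. *)
elim/ltn_ind => r IH; move: (eq_sum r); rewrite !big_ord_recr /= binn !mulr1.
rewrite (eq_bigr (fun i : 'I_r => (c i)%:~R * 'C(r, i)%:R)) => [/addrI //|i _].
by rewrite IH.
Qed.

(** * Elementary symmetric functions of consecutive integers *)

(* e_k(0, 1, ..., n - 1) *)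
Fixpoint esym_iota (n k : nat) : int :=
  if n is n'.+1 then
    esym_iota n' k + n'%:R * (if k is k'.+1 then esym_iota n' k' else 0)
  else (k == 0)%:R.

Definition bcoef0 (k r : nat) : int :=
  (derangements r k)%:R + (derangements r.+1 k)%:R.

Lemma bcoef0SS k r :
  bcoef0 k.+1 r.+1 = r.+1%:R * bcoef0 k r + r%:R * bcoef0 k r.-1.
Proof.
have kE : k.+1%:Z - 1 = k by rewrite -addn1 PoszD addrK.
have S m : (derangements m.+2 k.+1)%:R = m.+1%:R * bcoef0 k m.
  by rewrite derangementsSS kE natrM natrD addrC.
rewrite {1}/bcoef0 (S r) addrC; congr (_ + _).
(* For r = 0 both sides vanish: D(1, k + 1) = 0 on the left, the factor [r%:R] on the right. *)
by case: r => [|r]; rewrite ?derangements1 ?mul0r ?S.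
Qed.

(** Only the identity of n points has n cycles, so D(n, 0) = 0 for n > 0; this matches e_0 = 1. *)
Lemma bcoef0_0S r : bcoef0 0 r.+1 = 0.
Proof.
have SS0 m : derangements m.+2 0%N = 0%N.
  by rewrite derangementsSS !(derangements_lt0 _ (z := 0 - 1)) // muln0.
by case: r => [|r]; rewrite /bcoef0 ?derangements1 !SS0.
Qed.

Lemma esym_iotaE d k : esym_iota d.+1 k = binom_sum (bcoef0 k) d.
Proof.
elim: d k => [|d IH] k.
  rewrite /binom_sum big_ord1 mulr1 /bcoef0 derangements0 derangements1.
  by rewrite /= mul0r.
rewrite binom_sumS binom_sumD -IH /= -/(esym_iota d.+1 _); congr (_ + _).
case: k => [|k].
  by rewrite mulr0 /binom_sum big1 // => r _; rewrite bcoef0_0S mul0r.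
rewrite -[_ + _ * _]/(esym_iota d.+1 k) IH.
under [RHS]eq_binom_sum => r do rewrite bcoef0SS.
(* Multiplying by d + 1 sends b_r to b_r + r (b_r + b_(r-1)), the right-hand side of [bcoef0SS]. *)
rewrite mulrS mulrDl mul1r binom_sum_mulr -binom_sumD; apply: eq_binom_sum => r.
by rewrite -addn1 natrD; ring.
Qed.

(** * Monomial coefficients of c_k(2, d) and of Schur polynomials *)

Definition mon (a b : nat) : 'X_{1..2} := (U_(ord0) *+ a + U_(ord_max) *+ b)%MM.

Lemma mon0E a b : mon a b ord0 = a.
Proof. by rewrite mnmDE !mulmnE !mnm1E /=; lia. Qed.

Lemma mon1E a b : mon a b ord_max = b.
Proof. by rewrite mnmDE !mulmnE !mnm1E /=; lia. Qed.

Lemma mon_eq a b c d : (mon a b == mon c d) = (a == c) && (b == d).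
Proof.
apply/eqP/andP => [eq_mon|[/eqP -> /eqP ->] //].
by rewrite -(mon0E a b) -{2}(mon1E a b) eq_mon mon0E mon1E.
Qed.

Lemma mdeg_mon a b : mdeg (mon a b) = (a + b)%N.
Proof. by rewrite mdegD !mdegMn !mdeg1 !mul1n. Qed.

Lemma monXE a b : x1 ^+ a * x2 ^+ b = 'X_[mon a b].
Proof. by rewrite mpolyXD !mpolyXn. Qed.

Lemma mcoeff_mulX_eq0 n (R : nzRingType) (p : {mpoly R[n]}) (i : 'I_n)
  (m : 'X_{1..n}) : m i = 0%N -> (p * 'X_i)@_m = 0.
Proof.
move=> mi; rewrite {1}[p]mpolyE mulr_suml raddf_sum big1 //= => l _.
rewrite -scalerAl mcoeffZ -mpolyXD mcoeffX.
case: eqP => [e|]; last by rewrite mulr0.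
by move: mi; rewrite -e mnmDE mnm1E eqxx addn1.
Qed.

Lemma mcoeff_mulx1 p a b :
  (p * x1)@_(mon a b) = if a is a'.+1 then p@_(mon a' b) else 0.
Proof.
case: a => [|a]; first by rewrite mcoeff_mulX_eq0 ?mon0E.
by rewrite /mon mulmS -addmA mcoeffMX.
Qed.

Lemma mcoeff_mulx2 p a b :
  (p * x2)@_(mon a b) = if b is b'.+1 then p@_(mon a b') else 0.
Proof.
case: b => [|b]; first by rewrite mcoeff_mulX_eq0 ?mon1E.
by rewrite /mon mulmS addmC -addmA mcoeffMX addmC.
Qed.

Lemma mcoeff_pihomog n (R : nzRingType) (p : {mpoly R[n]}) k m :
  (pihomog mdeg k p)@_m = if mdeg m == k then p@_m else 0.
Proof.
rewrite pihomogE [in RHS](mpolyE p) !raddf_sum /= big_mkcond /=.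
case: ifP => mk; last apply: big1; [apply: eq_bigr|] => l _; case: ifP => lk //.
- by rewrite mcoeffZ mcoeffX; case: (l =P m) lk => [->|]; rewrite ?mk ?mulr0.
- by rewrite mcoeffZ mcoeffX; case: (l =P m) lk => [->|]; rewrite ?mk ?mulr0.
Qed.

(** Separating [n] from [d] allows induction on the number of factors with [d] fixed; n = d + 1
    gives the full product. *)
Definition partial_c2 (d n : nat) : {mpoly int[2]} :=
  \prod_(i < n) (1 + x1 *+ i + x2 *+ (d - i)).

Lemma mcoeff_partial_c2S d n a b :
  (partial_c2 d n.+1)@_(mon a b) =
  (partial_c2 d n)@_(mon a b)
  + n%:R * (if a is a'.+1 then (partial_c2 d n)@_(mon a' b) else 0)
  + (d - n)%:R * (if b is b'.+1 then (partial_c2 d n)@_(mon a b') else 0).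
Proof.
rewrite {1}/partial_c2 big_ord_recr -/(partial_c2 d n) /= !mulrDr mulr1.
by rewrite !mulrnAr !mcoeffD !mcoeffMn mcoeff_mulx1 mcoeff_mulx2 !mulr_natl.
Qed.

Lemma mcoeff_partial_c2_0 d a b :
  (partial_c2 d 0)@_(mon a b) = ((a == 0) && (b == 0))%N%:R.
Proof.
have mon00 : mon 0 0 = 0%MM by rewrite /mon !mulm0n addm0.
by rewrite /partial_c2 big_ord0 mcoeff1 -mon00 mon_eq.
Qed.

Lemma mcoeff_partial_c2_x1 d n k :
  (partial_c2 d n)@_(mon k 0) = esym_iota n k.
Proof.
elim: n k => [|n IH] k; first by rewrite mcoeff_partial_c2_0 andbT.
by rewrite mcoeff_partial_c2S mulr0 addr0 /= IH; case: k => [|k]; rewrite ?IH.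
Qed.

(* This is [\sum_(i < n) (d - i) e_k(j : j < n, j != i)]. *)
Lemma mcoeff_partial_c2_x1x2 d n k : (n <= d.+1)%N ->
  (partial_c2 d n)@_(mon k 1) =
  d%:R * (n%:R - k%:R) * esym_iota n k - k.+1%:R * esym_iota n k.+1.
Proof.
elim: n k => [|n IH] k le_nd.
  rewrite mcoeff_partial_c2_0 andbF /= mulr0 subr0 sub0r.
  by case: k => [|k]; rewrite ?oppr0 ?mulr0 ?mul0r.
(* As n <= d, the truncated [d - n] is a true difference. *)
rewrite mcoeff_partial_c2S IH ?(ltnW le_nd) // mcoeff_partial_c2_x1 natrB //.
by case: k => [|k] /=; rewrite ?IH ?(ltnW le_nd) // -!natr1; ring.
Qed.

Lemma c2_mcoeff k d a b : (a + b)%N = k ->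
  (c2 k d)@_(mon a b) = (partial_c2 d d.+1)@_(mon a b).
Proof. by move=> <-; rewrite mcoeff_pihomog mdeg_mon eqxx. Qed.

Lemma schur2_mcoeff a b c e :
  (schur2 a b)@_(mon c e) =
  \sum_(i < (a - b).+1) (((a - i)%N == c) && ((b + i)%N == e))%:R.
Proof.
rewrite raddf_sum; apply: eq_bigr => i _ /=.
by rewrite monXE mcoeffX mon_eq.
Qed.

Lemma schur2_mcoeff_x1 k j :
  (j <= k./2)%N -> (schur2 (k - j) j)@_(mon k 0) = (j == 0)%N%:R.
Proof.
move=> le_jk; rewrite schur2_mcoeff big_ord_recl /= big1 => [|i _].
  rewrite addr0 addn0 subn0.
  by case: j le_jk => [|j] _; rewrite ?subn0 ?eqxx ?andbF.
by rewrite /bump add1n addnS andbF.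
Qed.

(** The exponent j + i of [x2] is 1 only for (j, i) = (0, 1) and (1, 0). *)
Lemma schur2_mcoeff_x1x2 k j : (2 <= k)%N ->
  (j <= k./2)%N -> (schur2 (k - j) j)@_(mon k.-1 1) = (j <= 1)%N%:R.
Proof.
move=> k_ge2 le_jk; rewrite schur2_mcoeff.
case: j le_jk => [|[|j]] le_jk.
- rewrite subn0 (bigD1 (inord 1)) //= inordK; last by lia.
  rewrite big1 => [|i /eqP i1]; first by rewrite subn0 subn1 add0n !eqxx addr0.
  case: (eqVneq (0 + i)%N 1%N) => [e|]; last by rewrite andbF.
  by case: i1; apply/val_inj; rewrite /= inordK; lia.
- rewrite big_ord_recl big1 => [|i _].
    by rewrite /= subn0 subn1 !eqxx addr0.
  by rewrite /= andbC.
- by rewrite big1 // => i _; rewrite andbC.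
Qed.

(** * The Schur coefficients for j = 0 and j = 1 *)

Lemma schur_coef0E A k d : schur_coefficients A ->
  A k 0%N d = esym_iota d.+1 k.
Proof.
move=> /(_ k d) /(congr1 (mcoeff (mon k 0))).
rewrite c2_mcoeff ?addn0 // mcoeff_partial_c2_x1 => ->.
rewrite raddf_sum big_ord_recl /= mcoeffZ schur2_mcoeff_x1 // mulr1.
rewrite big1 ?addr0 //.
by move=> i _; rewrite mcoeffZ schur2_mcoeff_x1 ?mulr0 // lift0.
Qed.

Lemma schur_coef1E A k d : schur_coefficients A -> (0 < k)%N ->
  A k.+1 1%N d =
  d%:R * (d%:R + 1 - k%:R) * esym_iota d.+1 k - k.+2%:R * esym_iota d.+1 k.+1.
Proof.
move=> hA k_gt0; have /(congr1 (mcoeff (mon k 1))) := hA k.+1 d.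
rewrite c2_mcoeff ?addn1 // mcoeff_partial_c2_x1x2 // raddf_sum.
(* The sum thus has at least the terms j = 0 and j = 1, the only ones that contribute. *)
have k1 : k.+1./2 = k.+1./2.-1.+1 by case: k k_gt0.
rewrite (eq_bigr (fun j : 'I__ => A k.+1 j d * (j <= 1)%N%:R)); last first.
  by move=> j _; rewrite /= mcoeffZ -(@schur2_mcoeff_x1x2 k.+1) // -ltnS.
rewrite k1 !big_ord_recl /= big1 => [|j _]; last by rewrite mulr0.
rewrite (schur_coef0E _ _ hA) !mulr1 addr0 => e.
apply: (addrI (esym_iota d.+1 k.+1)); by rewrite -e -!natr1 /=; ring.
Qed.

(* The coefficients in the binomial basis of
   d (d + 1 - k) e_k - (k + 2) e_(k+1), which is A_(k+1,1). *)
Definition bcoef1 (k r : nat) : int :=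
  r%:R * ((r%:R + 1 - k%:R) * bcoef0 k r + (r%:R *+ 2 - k%:R) * bcoef0 k r.-1
          + (r%:R - 1) * bcoef0 k r.-2)
  - k.+2%:R * bcoef0 k.+1 r.

Lemma schur_coef1_binom A k : schur_coefficients A -> (0 < k)%N ->
  A k.+1 1%N =1 binom_sum (bcoef1 k).
Proof.
move=> hA k_gt0 d; rewrite schur_coef1E // !esym_iotaE.
(* The factor d + 1 - k is applied first and d second, each time through [binom_sum_mulr]. *)
have e0 : (d%:R + 1 - k%:R) * binom_sum (bcoef0 k) d =
    binom_sum (fun r => r%:R * (bcoef0 k r + bcoef0 k r.-1)
                        + (1 - k%:R) * bcoef0 k r) d.
  rewrite [RHS]binom_sumD (binom_sumZ (1 - k%:R) (bcoef0 k)).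
  by rewrite -(binom_sum_mulr (bcoef0 k)); ring.
rewrite -mulrA e0 binom_sum_mulr -mulNr -[X in _ + X]binom_sumZ -binom_sumD.
apply: eq_binom_sum => r; rewrite /bcoef1.
by case: r => [|r] /=; rewrite -?natr1; ring.
Qed.

Local Arguments derangements : simpl never.

(** The recurrence lowers D(_, k + 1) to D(_, k); it remains to compare the polynomial factors of
    D(_, k). The cases r = 0 and r = 1 are separate because [r.-1] and [r.-2] truncate, whereas a
    negative argument of D gives 0. *)
Lemma bcoef1E (k r : nat) : (0 < k)%N ->
  let D (N K : int) : int := (derangements N K)%:Z in
  bcoef1 k r =
  r%:Z * (r%:Z + 2 - k.+1%:Z) * D (r%:Z + 1) (k.+1%:Z - 1)
  + r%:Z * (3 * r%:Z + 2 - 3 * k.+1%:Z) * D r%:Z (k.+1%:Z - 1)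
  + (3 * r%:Z ^+ 2 - 3 * k.+1%:Z * r%:Z - 2 * r%:Z + k.+1%:Z + 1)
    * D (r%:Z - 1) (k.+1%:Z - 1)
  + (r%:Z - 1) * (r%:Z - k.+1%:Z - 1) * D (r%:Z - 2) (k.+1%:Z - 1).
Proof.
move=> k_gt0 /=.
have kE : k.+1%:Z - 1 = k by rewrite -addn1 PoszD addrK.
have predE n : n.+1%:Z - 1 = n by rewrite -addn1 PoszD addrK.
have pred2E n : n.+2%:Z - 2 = n by rewrite -addn2 PoszD addrK.
have succE n : n%:Z + 1 = n.+1 by rewrite -addn1 PoszD.
rewrite kE succE /bcoef1 /bcoef0 !natz.
have D0 : derangements 0%N k = 0%N by rewrite derangements0 eqn0Ngt k_gt0.
have N0 n : derangements (Negz n) k = 0%N by [].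
have D1 := derangements1.
have DSS n : (derangements n.+2 k.+1)%:Z =
    n.+1%:Z * ((derangements n.+1 k)%:Z + (derangements n k)%:Z).
  by rewrite derangementsSS kE PoszM PoszD.
case: r => [|[|r]] /=.

- rewrite D0 (derangements0 k.+1) !D1 !N0 /=; ring.
- rewrite predE D0 DSS D0 !D1 !N0; ring.
rewrite predE pred2E !DSS -!succE; ring.
Qed.

Lemma bcoef1_ge0 (k r : nat) : (0 < k)%N -> 0 <= bcoef1 k r.
Proof.
move=> k_gt0; rewrite bcoef1E //.
have kE : k.+1%:Z - 1 = k by rewrite -addn1 PoszD addrK.
have mulD_ge0 (c N : int) : (k%:Z < N -> 0 <= c) ->
    0 <= c * (derangements N k)%:Z.
  move=> c_ge0; case: (ltrP k%:Z N) => [/c_ge0 ?|le_Nk]; first exact: mulr_ge0.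
  case: N le_Nk {c_ge0} => [n|n] le_nk; last by rewrite mulr0.
  by rewrite derangements_ge ?mulr0.
(* Where the respective D is nonzero, r is at least k, k + 1, k + 2 and k + 3, which makes the four
   factors nonnegative. *)
rewrite kE; apply: addr_ge0; [apply: addr_ge0; [apply: addr_ge0|]|];
  apply: mulD_ge0 => lt_kr; nia.
Qed.

Theorem theorem3p6
  (A : nat -> nat -> nat -> int)
  (B : nat -> nat -> nat -> rat)
  (hA : schur_coefficients A)
  (hB : forall k j : nat, (j <= k./2)%N ->
          binomial_coefficients (A k j) (B k j)) :
  (forall k r : nat, 0 <= B k 0%N r) /\
  (forall k r : nat, (2 <= k)%N -> 0 <= B k 1%N r) /\
  (forall k r : nat,
     B k 0%N r =
     (derangements r%:Z k%:Z)%:R + (derangements (r%:Z + 1) k%:Z)%:R) /\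
  (forall k r : nat, (2 <= k)%N ->
     let D (N K : int) : int := (derangements N K)%:Z in
     let k' : int := k%:Z in
     let r' : int := r%:Z in
     B k 1%N r =
     (r' * (r' + 2 - k') * D (r' + 1) (k' - 1)
      + r' * (3 * r' + 2 - 3 * k') * D r' (k' - 1)
      + (3 * r' ^+ 2 - 3 * k' * r' - 2 * r' + k' + 1) * D (r' - 1) (k' - 1)
      + (r' - 1) * (r' - k' - 1) * D (r' - 2) (k' - 1))%:~R).
Proof.
have B0 k r : B k 0%N r =
    (derangements r%:Z k%:Z)%:R + (derangements (r%:Z + 1) k%:Z)%:R.
  rewrite (binomial_coefficientsE (c := bcoef0 k) (hB _ _ (leq0n _))) //.
    by rewrite rmorphD !rmorph_nat -[r.+1]addn1 PoszD.
  by move=> d; rewrite schur_coef0E // esym_iotaE.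
have B1 k r : (0 < k)%N -> B k.+1 1%N r = (bcoef1 k r)%:~R.
  move=> k_gt0; have k1 : (1 <= k.+1./2)%N by case: k k_gt0.
  apply: (binomial_coefficientsE (hB _ _ k1)); exact: schur_coef1_binom.
split; first by move=> k r; rewrite B0 addr_ge0.
split; first by move=> [|k] r // k_gt0; rewrite B1 // ler0z bcoef1_ge0.
split=> // -[|k] r // k_gt0; rewrite B1 //; congr (_%:~R); exact: bcoef1E.
Qed.
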